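(* Let $k=k(n)$ be integers with $1\le k(n)\le n$ and $k(n)=o(n)$ as $n\to\infty$. Then the mixing time of the $(n,k)$ Bernoulli--Laplace urn model satisfies, for every $\varepsilon\in(0,1)$, $$t_{\mathrm{mix}}(\varepsilon)\le \frac{n}{4k}\log n+\frac{3n}{k}\log\log n+O\Big(\frac{n}{\varepsilon^4 k}\Big)\qquad\text{as } n\to\infty .$$ Explicitly: there is a universal constant $C\in(0,\infty)$ such that for every such sequence $k(n)$ and every $\varepsilon\in(0,1)$ there is $n_0$ such that for all $n\ge n_0$, $$t_{\mathrm{mix}}(\varepsilon)\le \frac{n}{4k}\log n+\frac{3n}{k}\log\log n+\frac{Cn}{\varepsilon^4k}.$$
   Context: The $(n,k)$ Bernoulli--Laplace urn model: there are two urns, each containing $n$ balls, with $n$ red balls and $n$ white balls in total. At each step one chooses a uniformly random set of $k$ balls from the left urn and, independently, a uniformly random set of $k$ balls from the right urn, and swaps these two sets simultaneously. $X_t$ is the number of red balls in the left urn after $t$ steps; $(X_t)$ is a Markov chain on $\mathcal X=\{0,1,\ldots,n\}$. Write $P^t_x(y)=\mathbb P(X_t=y\mid X_0=x)$. The stationary distribution is $\pi_n(j)=\binom nj\binom n{n-j}/\binom{2n}{n}$, $0\le j\le n$. Total variation distance is $\|\mu-\nu\|_{\mathrm{TV}}=\frac12\sum_{y}|\mu(y)-\nu(y)|$. The mixing time is $t_{\mathrm{mix}}(\varepsilon)=\min\{t\in\mathbb N:\max_{x\in\mathcal X}\|P^t_x-\pi_n\|_{\mathrm{TV}}\le\varepsilon\}$.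 *)

(* Defs.v *)
From HB Require Import structures.
From mathcomp Require Import all_boot all_order all_algebra.
From mathcomp Require Import all_classical all_reals all_analysis.

Set Implicit Arguments.
Unset Strict Implicit.
Unset Printing Implicit Defensive.

Import Order.TTheory GRing.Theory Num.Theory.

Local Open Scope ring_scope.

(* In each urn the n balls are labelled by 'I_n so that the red balls carry the
   smallest labels: when the left urn holds x <= n red balls, the right urn
   holds n - x of them. A and B are the sets of balls taken from the left and
   the right urn. The truncated subtraction is exact, since at most x red balls
   leave the left urn. *)
Definition bl_next (n x : nat) (A B : {set 'I_n}) : nat :=
  (x - #|[set i in A | (i < x)%N]| + #|[set i in B | (i < n - x)%N]|)%N.

(* A pair of uniformly random k-subsets of the two urns is a uniformly random
   element of a set of cardinality 'C(n, k) ^ 2. *)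
Definition bl_kernel (R : realType) (n k : nat) : 'M[R]_n.+1 :=
  \matrix_(x, y)
    (#|[set AB : {set 'I_n} * {set 'I_n} |
         [&& #|AB.1| == k, #|AB.2| == k & bl_next x AB.1 AB.2 == y]]|%:R
     / ('C(n, k) ^ 2)%:R).

Definition bl_law (R : realType) (n k t : nat) (x y : 'I_n.+1) : R :=
  (bl_kernel R n k ^+ t) x y.

Definition bl_stationary (R : realType) (n : nat) (j : 'I_n.+1) : R :=
  'C(n, j)%:R * 'C(n, n - j)%:R / 'C(2 * n, n)%:R.

Definition tv_dist (R : realType) (T : finType) (mu nu : T -> R) : R :=
  2^-1 * \sum_(y : T) `|mu y - nu y|.

Definition bl_worst_tv (R : realType) (n k t : nat) : R :=
  \big[Num.max/0]_(x : 'I_n.+1) tv_dist (bl_law R k t x) (@bl_stationary R n).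

(* Extended-real valued: for k = n the chain alternates between x and n - x, so
   for small eps no t qualifies, and the mixing time is +oo. *)
Definition bl_mixing_time (R : realType) (n k : nat) (eps : R) : \bar R :=
  match pselect (exists t : nat, bl_worst_tv R n k t <= eps) with
  | left ex => ((ex_minn ex)%:R)%:E
  | right _ => +oo%E
  end.

(* Main.v *)
Require Import Defs.
From HB Require Import structures.
From mathcomp Require Import all_boot all_order all_algebra.
From mathcomp Require Import all_classical all_reals all_analysis.
From mathcomp Require Import ring lra zify.

Set Implicit Arguments.
Unset Strict Implicit.
Unset Printing Implicit Defensive.

Import Order.TTheory GRing.Theory Num.Theory.
Import numFieldNormedType.Exports.

Local Open Scope ring_scope.

(* The Hahn polynomials of degree 0, ..., n diagonalise the chain for every k
   simultaneously: it is reversible and preserves the polynomials of degree at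
   most j, and its eigenvalue on the polynomial f_j with f_j(0) = 1 is f_j(k).
   Stochasticity of all these chains gives |f_j| <= 1, the difference equation
   of f_j gives |f_j(k)| <= exp(-2jk/n) for k <= n/256, and an explicit norm
   computation gives 1/|f_j|^2 <= (2n+1)^j. Hence the chi-square distance to
   equilibrium from any starting point is at most the sum over j >= 1 of
   ((2n+1) exp(-4kt/n))^j, which is small once t exceeds (n/4k) log n by a
   multiple of n/k. *)

(** The value f_j(k) is an alternating sum whose terms can be large, so it is never estimated as a
    sum. The generator of the chain with k = 1 is a second-order difference operator; it expresses
    f_j(x+1) through f_j(x) and f_j(x-1), and the estimate advances from x = 0 to x = k. With M =
    (n-j)^2 - j, the ratio f_j(x+1)/f_j(x) is at most M/n^2 <= (1-j/n)^2 <= exp(-2j/n) as long as M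
    >= 8kn. For smaller M positivity may fail, and the crude bound |f_j(k)| <= (16k/n)^k takes over;
    since 256 = 16^2, it is at most 16^(-k) <= exp(-2k). *)

(** * Counting draws and the one-step transition kernel *)

(** A set is determined by its traces on S and on the complement of S, which can be chosen
    independently. *)
Lemma card_draws_setI (T : finType) (S : {set T}) (k a : nat) : (a <= k)%N ->
  #|[set A : {set T} | (#|A| == k) && (#|A :&: S| == a)]|
  = ('C(#|S|, a) * 'C(#|T| - #|S|, k - a))%N.
Proof.
move=> leak; have -> : (#|T| - #|S|)%N = #|~: S| by rewrite -(cardsC S) addKn.
rewrite -(cards_draws S a) -(cards_draws (~: S) (k - a)%N) -cardsX.
rewrite -(card_in_imset (f := fun PQ : {set T} * {set T} => PQ.1 :|: PQ.2)).
  apply: eq_card => A; rewrite !inE; apply/idP/imsetP => [/andP[/eqP Ak /eqP ASa]|].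
    exists (A :&: S, A :&: ~: S) => /=; last by rewrite -finset.setIUr finset.setUCr finset.setIT.
    rewrite !inE /= !finset.subsetIr ASa eqxx /=.
    by rewrite -finset.setDE -ASa -Ak -(cardsID S A) addKn.
  case=> -[P Q]; rewrite !inE /= => /andP[/andP[PS /eqP Pa] /andP[QS /eqP Qb]] ->.
  have QS0 : Q :&: S = finset.set0 by apply/eqP; rewrite finset.setI_eq0 finset.disjoints_subset.
  have PQ0 : P :&: Q = finset.set0.
    by apply/eqP; rewrite -finset.subset0 -QS0 finset.setIC; apply: finset.setIS.
  rewrite finset.setIUl QS0 finset.setU0 (finset.setIidPl PS) Pa eqxx andbT.
  by rewrite cardsU PQ0 cards0 subn0 Pa Qb subnKC.
move=> [P Q] [P' Q']; rewrite !inE /=.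
move=> /andP[/andP[PS _] /andP[QS _]] /andP[/andP[PS' _] /andP[QS' _]] eqU.
have key (U V : {set T}) : U \subset S -> V \subset ~: S ->
    (U :|: V) :&: S = U /\ (U :|: V) :&: ~: S = V.
  move=> US VS; rewrite !finset.setIUl (finset.setIidPl US) (finset.setIidPl VS); split.
    by rewrite (_ : V :&: S = finset.set0) ?finset.setU0//; apply/eqP; rewrite finset.setI_eq0 finset.disjoints_subset.
  by rewrite (_ : U :&: ~: S = finset.set0) ?finset.set0U//; apply/eqP; rewrite finset.setI_eq0 finset.disjoints_subset finset.setCK.
have [PE QE] := key _ _ PS QS; have [PE' QE'] := key _ _ PS' QS'.
by congr (_, _); [rewrite -PE eqU PE' | rewrite -QE eqU QE'].
Qed.

Lemma card_ord_lt (n x : nat) : (x <= n)%N -> #|[set i : 'I_n | (i < x)%N]| = x.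
Proof.
move=> lexn; rewrite -sum1dep_card.
by rewrite -(big_ord_widen n (fun _ => 1%N) lexn) sum1_card card_ord.
Qed.

(** The number of red balls in a uniform draw is hypergeometric; [h] is arbitrary so that the two
    urns can be treated one after the other. *)
Lemma sum_draws (R : nzRingType) (n k x : nat) (h : nat -> R) : (x <= n)%N ->
  \sum_(A : {set 'I_n} | #|A| == k) h #|[set i in A | (i < x)%N]|
  = \sum_(a < k.+1) ('C(x, a) * 'C(n - x, k - a))%:R * h a.
Proof.
move=> lexn; set S := [set i : 'I_n | (i < x)%N].
have SE (A : {set 'I_n}) : [set i in A | (i < x)%N] = A :&: S by apply/finset.setP => i; rewrite !inE.
rewrite (partition_big (fun A : {set 'I_n} => inord #|A :&: S| : 'I_k.+1) xpredT) //=.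
apply: eq_bigr => a _.
have leak : (a <= k)%N by rewrite -ltnS.
have := card_draws_setI S leak; rewrite card_ord_lt // card_ord => <-.
rewrite -sum1dep_card natr_sum mulr_suml.
apply: eq_big => [A|A /andP[/eqP Ak /eqP Aa]].
  apply: andb_id2l => /eqP Ak; rewrite -val_eqE /= inordK // ltnS -Ak.
  exact/subset_leq_card/finset.subsetIl.
rewrite mul1r SE -Aa inordK // ltnS -Ak; exact/subset_leq_card/finset.subsetIl.
Qed.

Lemma bl_next_le (n x : nat) (A B : {set 'I_n}) : (x <= n)%N -> (bl_next x A B <= n)%N.
Proof.
move=> lexn; rewrite /bl_next.
suff : (#|[set i in B | (i < n - x)%N]| <= n - x)%N by lia.
rewrite -[X in (_ <= X)%N](card_ord_lt (leq_subr x n)); apply: subset_leq_card.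
by apply/fintype.subsetP => i; rewrite !inE => /andP[].
Qed.

(* [a] and [b] red balls leave the left and the right urn. *)
Lemma bl_kernel_sum (R : realType) (n k : nat) (x : 'I_n.+1) (g : nat -> R) :
  (k <= n)%N ->
  \sum_(y < n.+1) bl_kernel R n k x y * g y
  = ('C(n, k) ^ 2)%:R^-1 * \sum_(a < k.+1) \sum_(b < k.+1)
      ('C(x, a) * 'C(n - x, k - a))%:R * ('C(n - x, b) * 'C(x, k - b))%:R * g (x - a + b)%N.
Proof.
move=> lekn; have lexn : (x <= n)%N by rewrite -ltnS.
transitivity (('C(n, k) ^ 2)%:R^-1 *
  \sum_(A : {set 'I_n} | #|A| == k) \sum_(B : {set 'I_n} | #|B| == k) g (bl_next x A B)).
  rewrite pair_big_dep /= (partition_big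
    (fun AB : {set 'I_n} * {set 'I_n} => inord (bl_next x AB.1 AB.2) : 'I_n.+1) xpredT) //=.
  rewrite mulr_sumr; apply: eq_bigr => y _; rewrite mxE mulrAC mulrC; congr (_ * _).
  rewrite -sum1dep_card natr_sum mulr_suml; apply: eq_big => [[A B]|[A B]] /=.
    by rewrite -andbA; congr [&& _, _ & _]; rewrite -val_eqE /= inordK // ltnS bl_next_le.
  by move=> /and3P[_ _ /eqP ->]; rewrite mul1r.
congr (_ * _).
pose h a := \sum_(b < k.+1) ('C(n - x, b) * 'C(x, k - b))%:R * g (x - a + b)%N.
transitivity (\sum_(A : {set 'I_n} | #|A| == k) h #|[set i in A | (i < x)%N]|).
  apply: eq_bigr => A _ /=; rewrite /bl_next /h.
  have := @sum_draws R n k (n - x)%N (fun b => g (x - #|[set i in A | (i < x)%N]| + b)%N) (leq_subr _ _).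
  by rewrite subKn.
rewrite sum_draws //; apply: eq_bigr => a _; rewrite mulr_sumr.
by apply: eq_bigr => b _; rewrite mulrA.
Qed.

Lemma bl_kernel_ge0 (R : realType) (n k : nat) (x y : 'I_n.+1) : 0 <= bl_kernel R n k x y.
Proof. by rewrite mxE divr_ge0. Qed.

Lemma bl_kernel_sum1 (R : realType) (n k : nat) (x : 'I_n.+1) : (k <= n)%N ->
  \sum_(y < n.+1) bl_kernel R n k x y = 1.
Proof.
move=> lekn; have lexn : (x <= n)%N by rewrite -ltnS.
transitivity (\sum_(y < n.+1) bl_kernel R n k x y * 1); first by under [RHS]eq_bigr do rewrite mulr1.
rewrite (bl_kernel_sum x (fun=> 1)) //.
under eq_bigr do under eq_bigr do rewrite mulr1.
under eq_bigr do rewrite -mulr_sumr.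
rewrite -mulr_suml -!natr_sum !binomial.Vandermonde subnK // subnKC // -natrM mulnn mulVf //.
by rewrite pnatr_eq0 expn_eq0 andbT -lt0n bin_gt0.
Qed.

(** Both sides count the pairs of an x-set and a k-set of an n-set that meet in exactly a
    elements. *)
Lemma bin_trinomial (n k x a : nat) : (a <= k <= n)%N -> (a <= x <= n)%N ->
  ('C(n, x) * ('C(x, a) * 'C(n - x, k - a)) = 'C(n, k) * ('C(k, a) * 'C(n - k, x - a)))%N.
Proof.
move=> /andP[ak kn] /andP[ax xn]; have [le|gt] := leqP (k - a) (n - x); last first.
  by rewrite (bin_small gt) (@bin_small (n - k)) ?muln0 //; lia.
have le' : (x - a <= n - k)%N by lia.
have E : (n - k - (x - a) = n - x - (k - a))%N by lia.
have := bin_fact le'; have := bin_fact le; have := bin_fact kn; have := bin_fact xn.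
have := bin_fact ax; have := bin_fact ak; rewrite E.
have := fact_gt0 a; have := fact_gt0 (x - a); have := fact_gt0 (k - a).
have := fact_gt0 (n - x - (k - a)).
set p := (n - x - (k - a))`!; set q := (k - a)`!; set r := (x - a)`!; set s := a`!.
move=> p0 q0 r0 s0 <- <- E1 E2 F1 F2; move: E1 E2; rewrite -F1 -F2 => <- E2.
have : (0 < s * r * q * p)%N by rewrite !muln_gt0 p0 q0 r0 s0.
move/eqn_pmul2r => H; apply/eqP; rewrite -H; apply/eqP; lia.
Qed.

(** Detailed balance. By [bin_trinomial], used once per urn, the flow from x to y becomes a sum over
    (a, b) in which exchanging a and b amounts to exchanging x and y: undoing a swap sends back the
    b red balls that came and recovers the a that left. *)
Lemma bl_kernel_rev (R : realType) (n k : nat) (x y : 'I_n.+1) : (k <= n)%N ->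
  'C(n, x)%:R ^+ 2 * bl_kernel R n k x y = 'C(n, y)%:R ^+ 2 * bl_kernel R n k y x.
Proof.
move=> lekn.
have sym (u v : 'I_n.+1) : 'C(n, u)%:R ^+ 2 * bl_kernel R n k u v =
   \sum_(a < k.+1) \sum_(b < k.+1)
     (if [&& a <= u, b <= n - u & v + a == u + b]%N
      then 'C(k, a) * 'C(k, b) * ('C(n - k, u - a) * 'C(n - k, n - u - b)) else 0)%:R.
  have leun : (u <= n)%N by rewrite -ltnS.
  have -> : bl_kernel R n k u v = \sum_(z < n.+1) bl_kernel R n k u z * (z == v :> nat)%:R.
    rewrite (bigD1 v) //= eqxx mulr1 big1 ?addr0 // => z zv.
    by rewrite (negPf zv : (z == v :> nat) = false) mulr0.
  rewrite (bl_kernel_sum u (fun z => (z == v)%:R)) // mulrA mulr_sumr; apply: eq_bigr => a _.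
  rewrite mulr_sumr; apply: eq_bigr => b _.
  have [leau|ltua] := leqP a u; last by rewrite (bin_small ltua) mul0n !mul0r mulr0.
  have [lebu|ltub] := leqP b (n - u); last by rewrite (bin_small ltub) mul0n !(mul0r,mulr0).
  have -> : (u - a + b == v)%N = (v + a == u + b)%N by lia.
  case: ifP => [/= ->|/= ->]; last by rewrite !mulr0.
  rewrite mulr1; have ak : (a <= k)%N by rewrite -ltnS.
  have bk : (b <= k)%N by rewrite -ltnS.
  have T1 := @bin_trinomial n k u a; rewrite ak lekn leau leun in T1.
  have T2 := @bin_trinomial n k (n - u) b.
  rewrite bk lekn lebu leq_subr subKn // bin_sub // in T2.
  have c0 : 'C(n, k)%:R != 0 :> R by rewrite pnatr_eq0 -lt0n bin_gt0.
  apply: (mulfI c0); apply: (mulfI c0); rewrite natrX.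
  move: (congr1 (fun z => z%:R : R) (T1 isT isT)) (congr1 (fun z => z%:R : R) (T2 isT isT)).
  rewrite !natrM => E1 E2.
  transitivity (('C(n, u)%:R * ('C(u, a)%:R * 'C(n - u, k - a)%:R)) *
   ('C(n, u)%:R * ('C(n - u, b)%:R * 'C(u, k - b)%:R)) : R); first by field.
  by rewrite E1 E2; ring.
rewrite !sym exchange_big; apply: eq_bigr => a _; apply: eq_bigr => b _ /=.
have lex : (x <= n)%N by rewrite -ltnS.
have ley : (y <= n)%N by rewrite -ltnS.
have -> : [&& b <= x, a <= n - x & y + b == x + a]%N = [&& a <= y, b <= n - y & x + a == y + b]%N by lia.
case: ifP => // /and3P[_ _ /eqP E].
have -> : (x - b = y - a)%N by lia. have -> : (n - x - a = n - y - b)%N by lia.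
by congr (_%:R); ring.
Qed.

(** If the left urn holds no red ball, all k arriving balls are red, so the chain moves from 0 to k
    with certainty. Hence an eigenfunction equal to 1 at 0 has its eigenvalue as its value at k. *)
Lemma bl_kernel_mul0 (R : realType) (n k : nat) (g : nat -> R) : (k <= n)%N ->
  \sum_(y < n.+1) bl_kernel R n k ord0 y * g y = g k.
Proof.
move=> lekn; rewrite bl_kernel_sum //= big_ord_recl bin0 subn0.
rewrite [X in _ + X]big1 ?addr0 => [|i _]; last by rewrite big1 // => j _; rewrite lift0 bin0n mul0n !mul0r.
rewrite big_ord_recr big1 ?add0r /= => [|i _]; last first.
  by rewrite bin0n subn_eq0 leqNgt ltn_ord muln0 mulr0 mul0r.
rewrite !subn0 subnn bin0 muln1 mul1n add0r add0n mulrA -natrM mulnn mulVf ?mul1r //.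
by rewrite pnatr_eq0 expn_eq0 andbT -lt0n bin_gt0.
Qed.

(** Swapping all n balls exchanges the urns and sends n to 0. *)
Lemma bl_kernel_mulnn (R : realType) (n : nat) (g : nat -> R) :
  \sum_(y < n.+1) bl_kernel R n n ord_max y * g y = g 0%N.
Proof.
rewrite bl_kernel_sum //= subnn binn exp1n invr1 mul1r.
rewrite big_ord_recr big1 ?add0r /= => [|i _]; last first.
  by rewrite big1 // => j _; rewrite bin0n subn_eq0 leqNgt ltn_ord muln0 mul0r mul0r.
rewrite big_ord_recl big1 ?addr0 /= => [|i _]; last by rewrite subnn bin0n mul0n mulr0 mul0r.
by rewrite add0r subn0 subnn !binn !mul1r.
Qed.

(** * Action of the kernel on binomial polynomials *)

(** A disjoint pair of an m-set and a p-set can be chosen in either order. *)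
Lemma bin_mul_bin (n m p : nat) : ('C(n, m) * 'C(n - m, p) = 'C(n, p) * 'C(n - p, m))%N.
Proof.
have [le|gt] := leqP (m + p) n; last first.
  have [lm|gm] := leqP m n; last by rewrite (bin_small gm) (@bin_small (n - p) m) ?muln0 //; lia.
  rewrite (@bin_small (n - m)) ?muln0; last by lia.
  have [lp|gp] := leqP p n; last by rewrite (bin_small gp).
  by rewrite (@bin_small (n - p) m) ?muln0 //; lia.
have := @bin_trinomial n (m + p) m m; rewrite leq_addr le leqnn /= subnn bin0 muln1.
have := @bin_trinomial n (m + p) p p; rewrite leq_addl le leqnn /= subnn bin0 muln1.
have lm : (m <= n)%N by lia. have lp : (p <= n)%N by lia.
rewrite !binn lm lp !mul1n addKn addnK => -> // -> //; congr (_ * _)%N.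
by rewrite -[RHS]bin_sub ?leq_addl // addnK.
Qed.

(* The chain maps [C(x, l)] to a polynomial of degree at most [l] in [x]. *)
Lemma bl_kernel_bin (R : realType) (n k l : nat) : (k <= n)%N ->
  exists c : nat -> R, forall x : 'I_n.+1,
    \sum_(y < n.+1) bl_kernel R n k x y * 'C(y, l)%:R =
    \sum_(m < l.+1) c m * ('C(x, l - m)%:R * 'C(n - x, m)%:R).
Proof.
(* An l-set of red balls in the new left urn consists of l - m balls that stayed and m that arrived.
   The factor C(n-(l-m), k) counts left draws avoiding the former, C(n-m, k-m) right draws
   containing the latter; the [if] excludes m > k, where truncated subtraction would give 1. *)
move=> lekn; exists (fun m => ('C(n, k) ^ 2)%:R^-1 * 'C(n - (l - m), k)%:R *
  (if (m <= k)%N then 'C(n - m, k - m)%:R else 0)) => x.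
have lexn : (x <= n)%N by rewrite -ltnS.
rewrite (bl_kernel_sum x (fun y => 'C(y, l)%:R)) //.
have S1 p : (\sum_(a < k.+1) 'C(x, a) * 'C(n - x, k - a) * 'C(x - a, p) = 'C(x, p) * 'C(n - p, k))%N.
  have [lepx|gt] := leqP p x; last first.
    by rewrite (bin_small gt) big1 // => a _; rewrite (@bin_small (x - a)) ?muln0 //; lia.
  rewrite (_ : n - p = (x - p) + (n - x))%N; last by lia.
  rewrite -binomial.Vandermonde big_distrr /=; apply: eq_bigr => a _.
  by rewrite mulnAC bin_mul_bin mulnA.
have S2 m : (\sum_(b < k.+1) 'C(n - x, b) * 'C(x, k - b) * 'C(b, m) =
    'C(n - x, m) * (if m <= k then 'C(n - m, k - m) else 0))%N.
  case: ifP => [lemk|/negbT]; last first.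
    rewrite -ltnNge muln0 => ltkm; rewrite big1 // => b _.
    by rewrite (@bin_small b) ?muln0 //; apply: leq_trans ltkm; exact: ltn_ord.
  have [le|gt] := leqP m (n - x); last first.
    rewrite (bin_small gt) mul0n big1 // => b _.
    have [lb|gb] := leqP b (n - x); last by rewrite (bin_small gb).
    by rewrite (@bin_small b) ?muln0 //; lia.
  rewrite (_ : n - m = (n - x - m) + x)%N; last by lia.
  rewrite -binomial.Vandermonde big_distrr /=.
  rewrite -(big_mkord xpredT (fun b => 'C(n - x, b) * 'C(x, k - b) * 'C(b, m))%N).
  rewrite (@big_cat_nat _ _ _ m) //=; last by lia.
  rewrite big_nat big1 ?add0n; last by move=> b /andP[_ ?]; rewrite (@bin_small b) ?muln0.
  rewrite -{1}(add0n m) big_addn subSn // big_mkord; apply: eq_bigr => b _.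
  rewrite mulnAC [RHS]mulnA; congr (_ * _)%N; last by congr 'C(_, _); lia.
  have [lb|gb] := leqP (b + m) (n - x).
    have := @bin_trinomial (n - x) (b + m) m m.
    by rewrite leq_addl lb leqnn le /= binn mul1n subnn bin0 muln1 addnK => ->.
  by rewrite (bin_small gb) (@bin_small (n - x - m)) ?muln0 //; lia.
transitivity (('C(n, k) ^ 2)%:R^-1 * \sum_(m < l.+1)
   (\sum_(a < k.+1) 'C(x, a) * 'C(n - x, k - a) * 'C(x - a, l - m))%:R *
   (\sum_(b < k.+1) 'C(n - x, b) * 'C(x, k - b) * 'C(b, m))%:R : R).
  congr (_ * _).
  transitivity (\sum_(a < k.+1) \sum_(b < k.+1) \sum_(m < l.+1)
     ('C(x, a) * 'C(n - x, k - a) * 'C(x - a, l - m))%:R *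
     ('C(n - x, b) * 'C(x, k - b) * 'C(b, m))%:R : R).
    apply: eq_bigr => a _; apply: eq_bigr => b _.
    rewrite addnC -binomial.Vandermonde natr_sum mulr_sumr; apply: eq_bigr => m _.
    by rewrite !natrM; ring.
  under eq_bigr do rewrite exchange_big.
  rewrite exchange_big; apply: eq_bigr => m _; rewrite !natr_sum mulr_suml.
  by apply: eq_bigr => a _; rewrite mulr_sumr.
rewrite mulr_sumr; apply: eq_bigr => m _; rewrite S1 S2.
by case: ifP => _; rewrite ?muln0 ?mulr0 ?mul0r ?mulr0 // !natrM; ring.
Qed.

(** * Hahn polynomials and the generator of the chain with k = 1 *)

Section Hahn.
Variables (R : realFieldType) (n : nat).
Implicit Types (g h : nat -> R) (i j l m x : nat).

(** Up to sign, the diagonal entry of [bl_gen] in the binomial basis ([bl_gen_binS]). *)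
Definition hahn_eig j : R := j%:R * (2 * n%:R + 1 - j%:R).

(* The recurrence makes [hahn j] an eigenfunction of [bl_gen]: the coefficients
   are [(-1)^i (j)_i (2n+1-j)_i / ((n)_i)^2] with falling factorials, so they
   vanish for [i > j]; the division by zero at [i = n] gives [0]. *)
Fixpoint hahn_coef j i : R :=
  if i is i'.+1 then
    hahn_coef j i' * (hahn_eig i' - hahn_eig j) / (n%:R - i'%:R) ^+ 2
  else 1.

(** For j <= n this is 3F2(-j, j-2n-1, -x; -n, -n; 1), the Hahn polynomial with parameters alpha =
    beta = -n-1 and N = n. *)
Definition hahn j x : R := \sum_(i < n.+1) hahn_coef j i * 'C(x, i)%:R.

Definition bl_weight x : R := 'C(n, x)%:R ^+ 2.

Definition bl_dot g h : R := \sum_(x < n.+1) bl_weight x * g x * h x.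

(* [n^2] times the generator of the chain with k = 1 *)
Definition bl_gen g x : R :=
  (n%:R - x%:R) ^+ 2 * (g x.+1 - g x) + x%:R ^+ 2 * (g x.-1 - g x).

Lemma hahn_eigB i j : hahn_eig i - hahn_eig j = (i%:R - j%:R) * (2 * n%:R + 1 - i%:R - j%:R).
Proof. by rewrite /hahn_eig; ring. Qed.

Lemma hahn_eig_inj i j : (i <= n)%N -> (j <= n)%N -> i != j -> hahn_eig i - hahn_eig j != 0.
Proof.
move=> lei lej nij; rewrite hahn_eigB mulf_neq0 //.
  by rewrite subr_eq0 eqr_nat.
have : (i%:R <= n%:R :> R) by rewrite ler_nat.
have : (j%:R <= n%:R :> R) by rewrite ler_nat.
by move=> ? ?; apply: lt0r_neq0; lra.
Qed.

Lemma hahn_eig0 : hahn_eig 0 = 0.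
Proof. by rewrite /hahn_eig mul0r. Qed.

Lemma bl_dotC g h : bl_dot g h = bl_dot h g.
Proof. by apply: eq_bigr => x _; ring. Qed.

Lemma eq_bl_dotr f g h : (forall x, (x <= n)%N -> g x = h x) -> bl_dot f g = bl_dot f h.
Proof. by move=> e; apply: eq_bigr => x _; rewrite e // -ltnS. Qed.

Lemma bl_dotD f g h : bl_dot f (fun x => g x + h x) = bl_dot f g + bl_dot f h.
Proof. by rewrite -big_split; apply: eq_bigr => x _; rewrite mulrDr. Qed.

Lemma bl_dotZ f (a : R) g : bl_dot f (fun x => a * g x) = a * bl_dot f g.
Proof. by rewrite mulr_sumr; apply: eq_bigr => x _; ring. Qed.

Lemma bl_dot_sum f p (g : nat -> nat -> R) :
  bl_dot f (fun x => \sum_(i < p) g i x) = \sum_(i < p) bl_dot f (g i).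
Proof. by rewrite exchange_big; apply: eq_bigr => x _; rewrite mulr_sumr. Qed.

(** Detailed balance for k = 1, up to the factor n^2. *)
Lemma bl_weightS x : (x < n)%N ->
  bl_weight x.+1 * x.+1%:R ^+ 2 = bl_weight x * (n%:R - x%:R) ^+ 2.
Proof.
move=> ltxn; rewrite /bl_weight -!exprMn; congr (_ ^+ 2).
by rewrite -natrB 1?ltnW // -!natrM mulnC mul_bin_left mulnC.
Qed.

Lemma bl_gen_sum p (c : nat -> R) (g : nat -> nat -> R) x :
  bl_gen (fun y => \sum_(i < p) c i * g i y) x = \sum_(i < p) c i * bl_gen (g i) x.
Proof.
rewrite /bl_gen -!sumrB !mulr_sumr -big_split; apply: eq_bigr => i _ /=; ring.
Qed.

(** Summation by parts; the boundary terms vanish because the rates (n-x)^2 and x^2 vanish at x = n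
    and x = 0. The result is a Dirichlet form, visibly symmetric in g and h. *)
Lemma bl_gen_dot g h :
  bl_dot h (bl_gen g) =
  - \sum_(x < n) bl_weight x * (n%:R - x%:R) ^+ 2 * (g x.+1 - g x) * (h x.+1 - h x).
Proof.
transitivity (\sum_(x < n.+1) bl_weight x * h x * ((n%:R - x%:R) ^+ 2 * (g x.+1 - g x)) +
   \sum_(x < n.+1) bl_weight x * h x * (x%:R ^+ 2 * (g x.-1 - g x))).
  by rewrite -big_split; apply: eq_bigr => x _; rewrite mulrDr.
rewrite big_ord_recr /= subrr expr0n mul0r mulr0 addr0.
rewrite [X in _ + X]big_ord_recl /= expr0n mul0r mulr0 add0r.
rewrite -big_split -sumrN; apply: eq_bigr => x _ /=.
rewrite /bump leq0n add1n /=.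
have := bl_weightS (ltn_ord x); set w1 := bl_weight x.+1 => E.
transitivity (bl_weight x * h x * ((n%:R - x%:R) ^+ 2 * (g x.+1 - g x)) +
  (w1 * x.+1%:R ^+ 2) * h x.+1 * (g x - g x.+1)); first by ring.
by rewrite E; ring.
Qed.

Lemma bl_gen_sym g h : bl_dot h (bl_gen g) = bl_dot (bl_gen h) g.
Proof.
rewrite [RHS]bl_dotC !bl_gen_dot; congr (- _); apply: eq_bigr => x _; ring.
Qed.

Lemma bl_gen_bin0 x : bl_gen (fun y => 'C(y, 0)%:R) x = 0.
Proof. by rewrite /bl_gen !bin0 subrr !mulr0 addr0. Qed.

(** The generator is bidiagonal in the binomial basis, which is why a one-term recurrence for the
    coefficients yields its eigenfunctions. *)
Lemma bl_gen_binS l x :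
  bl_gen (fun y => 'C(y, l.+1)%:R) x =
  - hahn_eig l.+1 * 'C(x, l.+1)%:R + (n%:R - l%:R) ^+ 2 * 'C(x, l)%:R.
Proof.
have E1 : l.+1%:R * 'C(x, l.+1)%:R = (x%:R - l%:R) * 'C(x, l)%:R :> R.
  have [le|gt] := leqP l x; first by rewrite -natrB // -!natrM mul_bin_left.
  by rewrite !bin_small ?mulr0 // ltnW.
have E2 : x%:R * ('C(x.-1, l.+1)%:R - 'C(x, l.+1)%:R) = - (l.+1%:R * 'C(x, l.+1)%:R) :> R.
  case: x {E1} => [|y]; first by rewrite !bin0n mul0r mulr0 oppr0.
  by rewrite [y.+1.-1]/= -!natrM -mul_bin_diag /= binS natrD !natrM; ring.
rewrite /bl_gen binS natrD.
transitivity ((n%:R - x%:R) ^+ 2 * 'C(x, l)%:R +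
  x%:R * (x%:R * ('C(x.-1, l.+1)%:R - 'C(x, l.+1)%:R)) : R); first by ring.
rewrite E2; transitivity (- (2 * n%:R - l%:R) * (l.+1%:R * 'C(x, l.+1)%:R) +
  (n%:R - l%:R) ^+ 2 * 'C(x, l)%:R : R); last by rewrite /hahn_eig; ring.
by rewrite E1; ring.
Qed.

Lemma hahn_coef_eq0 j i : (j < i)%N -> hahn_coef j i = 0.
Proof.
elim: i => // i IHi; rewrite ltnS leq_eqVlt /= => /predU1P[->|/IHi ->]; last by rewrite !mul0r.
by rewrite subrr mulr0 mul0r.
Qed.

Lemma hahn_coefS j i : (i < n)%N ->
  (n%:R - i%:R) ^+ 2 * hahn_coef j i.+1 = hahn_coef j i * (hahn_eig i - hahn_eig j).
Proof.
move=> lti /=; rewrite mulrC divfK // expf_neq0 // subr_eq0 eqr_nat.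
by rewrite gtn_eqF.
Qed.

Lemma hahn_at0 j : hahn j 0 = 1.
Proof.
rewrite /hahn big_ord_recl /= mul1r big1 ?addr0 // => i _.
by rewrite bin0n /= mulr0.
Qed.

Lemma hahn0 x : hahn 0 x = 1.
Proof.
rewrite /hahn big_ord_recl bin0 mul1r big1 ?addr0 // => i _.
by rewrite hahn_coef_eq0 ?mul0r.
Qed.

Lemma bl_gen_hahn j x : (j <= n)%N -> bl_gen (hahn j) x = - hahn_eig j * hahn j x.
Proof.
move=> lejn; rewrite /hahn (bl_gen_sum _ _ (fun i y => 'C(y, i)%:R)) big_ord_recl.
rewrite bl_gen_bin0 mulr0 add0r.
under eq_bigr => i _ do rewrite lift0 bl_gen_binS mulrDr.
rewrite big_split /=.
have -> : \sum_(i < n) hahn_coef j i.+1 * (- hahn_eig i.+1 * 'C(x, i.+1)%:R) =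
   \sum_(i < n.+1) hahn_coef j i * (- hahn_eig i * 'C(x, i)%:R).
  rewrite [RHS]big_ord_recl /= hahn_eig0 oppr0 mul0r mulr0 add0r.
  by apply: eq_bigr => i _; rewrite /bump leq0n add1n.
have -> : \sum_(i < n) hahn_coef j i.+1 * ((n%:R - i%:R) ^+ 2 * 'C(x, i)%:R) =
   \sum_(i < n.+1) hahn_coef j i * (hahn_eig i - hahn_eig j) * 'C(x, i)%:R.
  rewrite [RHS]big_ord_recr /=.
  (* This top term has no partner in the sum over i < n: it vanishes through the eigenvalue
     difference if j = n and through the coefficient if j < n. *)
  have -> : hahn_coef j n * (hahn_eig n - hahn_eig j) = 0.
    move: lejn; rewrite leq_eqVlt => /predU1P[->|ltj]; first by rewrite subrr mulr0.
    by rewrite hahn_coef_eq0 ?mul0r.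
  rewrite mul0r addr0; apply: eq_bigr => i _.
  by rewrite mulrA [_ * _ ^+ 2]mulrC hahn_coefS.
rewrite -big_split mulr_sumr; apply: eq_bigr => i _ /=; ring.
Qed.

Lemma hahn_dot_eig j g : (j <= n)%N ->
  bl_dot (hahn j) (bl_gen g) = - hahn_eig j * bl_dot (hahn j) g.
Proof.
move=> lejn; rewrite bl_gen_sym bl_dotC [in RHS]bl_dotC -bl_dotZ.
by apply: eq_bl_dotr => x _; rewrite bl_gen_hahn.
Qed.

Lemma hahn_dot_neq i j : (i <= n)%N -> (j <= n)%N -> i != j -> bl_dot (hahn i) (hahn j) = 0.
Proof.
move=> lei lej nij.
have : bl_dot (hahn i) (bl_gen (hahn j)) = - hahn_eig j * bl_dot (hahn i) (hahn j).
  by rewrite -bl_dotZ; apply: eq_bl_dotr => x _; rewrite bl_gen_hahn.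
rewrite hahn_dot_eig // => /eqP; rewrite -subr_eq0 -mulrBl opprK addrC mulf_eq0.
by rewrite (negPf (hahn_eig_inj lej lei _)) 1?eq_sym // => /eqP.
Qed.

(** Moving the generator across the product gives a recurrence for the moments of [hahn i] against
    binomials. Read upwards from l = 0 it yields orthogonality to lower degrees; read downwards from
    l = n it computes the norm. *)
Lemma hahn_dot_bin_step i l : (i <= n)%N ->
  (hahn_eig l.+1 - hahn_eig i) * bl_dot (hahn i) (fun x => 'C(x, l.+1)%:R) =
  (n%:R - l%:R) ^+ 2 * bl_dot (hahn i) (fun x => 'C(x, l)%:R).
Proof.
move=> lei; have := hahn_dot_eig (fun x => 'C(x, l.+1)%:R) lei.
rewrite (@eq_bl_dotr _ _ (fun x => - hahn_eig l.+1 * 'C(x, l.+1)%:R +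
   (n%:R - l%:R) ^+ 2 * 'C(x, l)%:R)); last by move=> x _; rewrite bl_gen_binS.
rewrite bl_dotD !bl_dotZ => E; rewrite mulrBl.
by move: E; rewrite !mulNr => E; lra.
Qed.

Lemma hahn_dot_bin i l : (l < i <= n)%N -> bl_dot (hahn i) (fun x => 'C(x, l)%:R) = 0.
Proof.
move=> /andP[+ lei]; elim: l => [|l IHl] lti.
  have := hahn_dot_eig (fun x => 'C(x, 0)%:R) lei.
  rewrite (@eq_bl_dotr _ _ (fun x => 0 * 0)); last by move=> x _; rewrite bl_gen_bin0 mul0r.
  rewrite bl_dotZ mul0r => /esym/eqP; rewrite mulf_eq0 oppr_eq0.
  have : hahn_eig i - hahn_eig 0 != 0 by rewrite hahn_eig_inj // -lt0n.
  by rewrite hahn_eig0 subr0 => /negPf -> /eqP.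
have /eqP := hahn_dot_bin_step l lei; rewrite IHl 1?ltnW // mulr0 mulf_eq0.
rewrite (negPf (hahn_eig_inj _ lei _)) /= => [/eqP //||]; first exact: leq_trans (ltnW lti) lei.
by rewrite ltn_eqF.
Qed.

(** Products of this kind are what [bl_kernel_bin] produces. An absorption identity lowers m while
    raising l by at most one, so the total degree never grows and the induction ends at
    [hahn_dot_bin]. *)
Lemma hahn_dot_bin2 i l m : (l + m < i <= n)%N ->
  bl_dot (hahn i) (fun x => 'C(x, l)%:R * 'C(n - x, m)%:R) = 0.
Proof.
elim: m l => [|m IHm] l /andP[lti lei].
  rewrite (@eq_bl_dotr _ _ (fun x => 'C(x, l)%:R)) => [|x _]; last by rewrite bin0 mulr1.
  by rewrite hahn_dot_bin // lei andbT -(addn0 l).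
have m0 : m.+1%:R != 0 :> R by rewrite pnatr_eq0.
apply: (mulfI m0); rewrite mulr0 -bl_dotZ.
rewrite (@eq_bl_dotr _ _ (fun x => (n%:R - m%:R - l%:R) * ('C(x, l)%:R * 'C(n - x, m)%:R) +
    (- l.+1%:R) * ('C(x, l.+1)%:R * 'C(n - x, m)%:R))).
  by rewrite bl_dotD !bl_dotZ !IHm ?mulr0 ?addr0 //; apply/andP; split=> //; lia.
move=> x lex.
have E1 : l.+1%:R * 'C(x, l.+1)%:R = (x%:R - l%:R) * 'C(x, l)%:R :> R.
  have [le|gt] := leqP l x; first by rewrite -natrB // -!natrM mul_bin_left.
  by rewrite !bin_small ?mulr0 // ltnW.
have E2 : m.+1%:R * 'C(n - x, m.+1)%:R = (n%:R - x%:R - m%:R) * 'C(n - x, m)%:R :> R.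
  rewrite -natrB //; have [le|gt] := leqP m (n - x); first by rewrite -natrB // -!natrM mul_bin_left.
  by rewrite !bin_small ?mulr0 // ltnW.
transitivity ('C(x, l)%:R * (m.+1%:R * 'C(n - x, m.+1)%:R) : R); first by ring.
rewrite E2; transitivity ((n%:R - m%:R - l%:R) * ('C(x, l)%:R * 'C(n - x, m)%:R) -
   (l.+1%:R * 'C(x, l.+1)%:R) * 'C(n - x, m)%:R : R); last by ring.
by rewrite E1; ring.
Qed.

Lemma hahn_dot_gt0 j : 0 < bl_dot (hahn j) (hahn j).
Proof.
rewrite /bl_dot big_ord_recl /= hahn_at0 /bl_weight bin0 expr1n !mulr1.
apply: ltr_wpDr => //; apply: sumr_ge0 => x _.
by rewrite -mulrA -expr2 mulr_ge0 // sqr_ge0.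
Qed.

End Hahn.

(** * Completeness of the Hahn basis *)

Section HahnExpansion.
Variables (R : realFieldType) (n : nat).
Implicit Types (g : nat -> R).

Lemma hahn_dot_delta (i j : 'I_n.+1) :
  bl_dot n (hahn R n i) (hahn R n j) / bl_dot n (hahn R n j) (hahn R n j) = (i == j)%:R.
Proof.
have [->|nij] := eqVneq i j; first by rewrite divff // gt_eqF // hahn_dot_gt0.
by rewrite hahn_dot_neq ?mul0r // -ltnS.
Qed.

(** Orthogonality says that [F] times [G] is the identity; for square matrices [G] times [F] is then
    the identity too, which is completeness. *)
Lemma hahn_expansion g (y : 'I_n.+1) :
  g y = \sum_(i < n.+1) bl_dot n (hahn R n i) g / bl_dot n (hahn R n i) (hahn R n i) * hahn R n i y.
Proof.
pose N (i : 'I_n.+1) := bl_dot n (hahn R n i) (hahn R n i).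
pose F : 'M[R]_n.+1 := \matrix_(j, x) hahn R n j x.
pose G : 'M[R]_n.+1 := \matrix_(x, j) (bl_weight R n x * hahn R n j x / N j).
have FG : F *m G = 1%:M.
  apply/matrixP => i j; rewrite !mxE -hahn_dot_delta mulr_suml.
  by apply: eq_bigr => x _; rewrite !mxE /N; ring.
have /matrixP GF := mulmx1C FG.
transitivity (\sum_(x < n.+1) g x * \sum_(i < n.+1) G x i * F i y).
  rewrite (bigD1 y) //= [X in _ + X]big1 ?addr0 => [|x xy].
    by have := GF y y; rewrite !mxE eqxx mulr1n => ->; rewrite mulr1.
  by have := GF x y; rewrite !mxE (negPf xy) => ->; rewrite mulr0.
under eq_bigr do rewrite mulr_sumr.
rewrite exchange_big; apply: eq_bigr => i _ /=; rewrite !mulr_suml.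
by apply: eq_bigr => x _; rewrite !mxE /N; ring.
Qed.

Lemma hahn_parseval g :
  bl_dot n g g =
  \sum_(i < n.+1) bl_dot n (hahn R n i) g ^+ 2 / bl_dot n (hahn R n i) (hahn R n i).
Proof.
transitivity (\sum_(y < n.+1) \sum_(i < n.+1) bl_weight R n y * g y *
  (bl_dot n (hahn R n i) g / bl_dot n (hahn R n i) (hahn R n i) * hahn R n i y)).
  by apply: eq_bigr => y _; rewrite -mulr_sumr -hahn_expansion.
rewrite exchange_big; apply: eq_bigr => i _ /=.
rewrite expr2 -mulrA mulrCA mulrC mulrA [X in X / _]/bl_dot !mulr_suml.
by apply: eq_bigr => y _; ring.
Qed.

End HahnExpansion.

(** * Spectral decomposition of the chain *)

Section Spectrum.
Variables (R : realType) (n : nat).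
Implicit Types (g h : nat -> R).

(** [bl_dot] takes functions on nat; [inord] extends the operator to them, and only the values at x
    <= n enter. *)
Let bl_op k g (x : nat) : R := \sum_(y < n.+1) bl_kernel R n k (inord x) y * g y.

Lemma bl_opE k g (x : 'I_n.+1) : bl_op k g x = \sum_(y < n.+1) bl_kernel R n k x y * g y.
Proof. by rewrite /bl_op inord_val. Qed.

Lemma bl_op_sym k g h : (k <= n)%N -> bl_dot n h (bl_op k g) = bl_dot n (bl_op k h) g.
Proof.
move=> lekn.
transitivity (\sum_(x < n.+1) \sum_(y < n.+1)
   (bl_weight R n x * bl_kernel R n k x y) * (h x * g y)).
  by apply: eq_bigr => x _; rewrite bl_opE mulr_sumr; apply: eq_bigr => y _; ring.
rewrite exchange_big; apply: eq_bigr => y _ /=; rewrite bl_opE mulr_sumr mulr_suml.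
by apply: eq_bigr => x _; rewrite /bl_weight bl_kernel_rev //; ring.
Qed.

(** The operator is self-adjoint, so j < i may be assumed; it then sends [hahn j] to degree at most
    j, to which [hahn i] is orthogonal. *)
Lemma hahn_dot_op k i j : (k <= n)%N -> (i <= n)%N -> (j <= n)%N -> i != j ->
  bl_dot n (hahn R n i) (bl_op k (hahn R n j)) = 0.
Proof.
move=> lekn; wlog ltji : i j / (j < i)%N.
  move=> H lei lej nij; have [ltij|ltji|eij] := ltngtP i j; last by rewrite eij eqxx in nij.
    by rewrite bl_op_sym // bl_dotC; apply: H => //; rewrite eq_sym.
  exact: H.
move=> lei lej _.
have [c cE] : exists c : nat -> nat -> R, forall l (x : 'I_n.+1),
    \sum_(y < n.+1) bl_kernel R n k x y * 'C(y, l)%:R =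
    \sum_(m < l.+1) c l m * ('C(x, l - m)%:R * 'C(n - x, m)%:R).
  have H l := @bl_kernel_bin R n k l lekn.
  by have [c cP] := choice H; exists c.
rewrite (@eq_bl_dotr _ _ _ _ (fun x => \sum_(l < n.+1) hahn_coef R n j l *
   \sum_(m < l.+1) c l m * ('C(x, l - m)%:R * 'C(n - x, m)%:R))); last first.
  move=> x lex; have -> : x = (Ordinal (lex : (x < n.+1)%N)) :> nat by [].
  rewrite bl_opE; under [RHS]eq_bigr do rewrite -cE mulr_sumr.
  rewrite exchange_big; apply: eq_bigr => y _ /=; rewrite mulr_sumr.
  by apply: eq_bigr => l _; ring.
rewrite (bl_dot_sum _ _ _ (fun l x => hahn_coef R n j l *
   \sum_(m < l.+1) c l m * ('C(x, l - m)%:R * 'C(n - x, m)%:R))) big1 // => l _.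
rewrite bl_dotZ; have [ltjl|lelj] := ltnP j l; first by rewrite hahn_coef_eq0 // mul0r.
rewrite (bl_dot_sum _ _ _ (fun m x => c l m * ('C(x, l - m)%:R * 'C(n - x, m)%:R))).
rewrite big1 ?mulr0 // => m _; rewrite bl_dotZ hahn_dot_bin2 ?mulr0 // lei andbT.
by rewrite subnK ?(leq_ltn_trans lelj ltji) // -ltnS.
Qed.

(* [hahn j] is an eigenvector since the subspaces of polynomials of given
   degree are invariant; the eigenvalue is read off at [x = 0]. *)
Lemma bl_kernel_hahn k j (x : 'I_n.+1) : (k <= n)%N -> (j <= n)%N ->
  \sum_(y < n.+1) bl_kernel R n k x y * hahn R n j y = hahn R n j k * hahn R n j x.
Proof.
move=> lekn lejn; pose j' : 'I_n.+1 := Ordinal (lejn : (j < n.+1)%N).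
have [c cE] : exists c, forall x : 'I_n.+1, bl_op k (hahn R n j) x = c * hahn R n j x.
  eexists => z; rewrite (hahn_expansion (bl_op k (hahn R n j)) z) (bigD1 j') //=.
  rewrite big1 ?addr0 // => i nij; rewrite hahn_dot_op ?mul0r //; by rewrite -ltnS.
rewrite -bl_opE cE; congr (_ * _).
by have := cE ord0; rewrite bl_opE bl_kernel_mul0 // hahn_at0 mulr1.
Qed.

(** f_j(x) is the eigenvalue of the chain that swaps x balls; the eigenvalue equation at a point
    where |f_j| is maximal bounds it by 1. *)
Lemma hahn_abs_le1 j x : (j <= n)%N -> (x <= n)%N -> `|hahn R n j x| <= 1.
Proof.
move=> lej lex; pose F (y : 'I_n.+1) := `|hahn R n j y|.
have [y _ /(_ _ isT) yM] := @arg_maxP _ _ _ ord0 xpredT F isT.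
have M0 : 0 < F y by apply: lt_le_trans (yM ord0); rewrite /F hahn_at0 normr1.
rewrite -(ler_pM2r M0) mul1r -normrM -bl_kernel_hahn //.
apply: le_trans (ler_norm_sum _ _ _) _.
rewrite -[leRHS]mul1r -(bl_kernel_sum1 R y lex) mulr_suml; apply: ler_sum => z _.
by rewrite normrM ger0_norm ?bl_kernel_ge0 // ler_wpM2l ?bl_kernel_ge0 //; exact: yM.
Qed.

(** The chain that swaps everything has eigenvalue f_j(n) and moves n to 0, where f_j is 1. *)
Lemma hahn_at_max_sqr j : (j <= n)%N -> hahn R n j n ^+ 2 = 1.
Proof.
move=> lej; have := @bl_kernel_hahn n j ord_max (leqnn n) lej.
by rewrite bl_kernel_mulnn hahn_at0 expr2 /= => <-.
Qed.

Lemma bl_law_hahn k t j (x : 'I_n.+1) : (k <= n)%N -> (j <= n)%N ->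
  \sum_(y < n.+1) bl_law R k t x y * hahn R n j y = hahn R n j k ^+ t * hahn R n j x.
Proof.
move=> lekn lejn; rewrite /bl_law; elim: t x => [|t IHt] x.
  rewrite (bigD1 x) //= expr0 mxE eqxx mulr1n big1 ?addr0 // => y yx.
  by rewrite mxE eq_sym (negPf yx) mul0r.
transitivity (\sum_(z < n.+1) bl_kernel R n k x z *
   \sum_(y < n.+1) (bl_kernel R n k ^+ t) z y * hahn R n j y).
  under [RHS]eq_bigr do rewrite mulr_sumr.
  rewrite exchange_big; apply: eq_bigr => y _ /=; rewrite exprS mxE mulr_suml.
  by apply: eq_bigr => z _; rewrite mulrA.
under eq_bigr do rewrite IHt mulrCA.
by rewrite -mulr_sumr bl_kernel_hahn // exprSr mulrA.
Qed.

Lemma bl_weight_gt0 x : (x <= n)%N -> 0 < bl_weight R n x.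
Proof. by move=> lex; rewrite exprn_gt0 // ltr0n bin_gt0. Qed.

Lemma bl_weight_sum : \sum_(x < n.+1) bl_weight R n x = 'C(2 * n, n)%:R.
Proof.
rewrite mul2n -addnn -binomial.Vandermonde natr_sum; apply: eq_bigr => x _.
have lex : (x <= n)%N by rewrite -ltnS.
by rewrite bin_sub // natrM.
Qed.

Lemma bl_stationaryE (x : 'I_n.+1) :
  bl_stationary R x = bl_weight R n x / 'C(2 * n, n)%:R.
Proof. by rewrite /bl_stationary bin_sub // -ltnS. Qed.

(** Parseval for [g], whose coefficient along f_j is the mean of f_j after t steps minus its
    stationary mean. For j = 0 both are 1; for j >= 1 the stationary mean is 0. Dividing by the
    unnormalised weight leaves a factor C(2n, n) to be restored later. *)
Lemma bl_law_chi2 k t (x : 'I_n.+1) : (k <= n)%N ->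
  \sum_(y < n.+1) (bl_law R k t x y - bl_stationary R y) ^+ 2 / bl_weight R n y =
  \sum_(j < n) (hahn R n j.+1 k ^+ t * hahn R n j.+1 x) ^+ 2 /
     bl_dot n (hahn R n j.+1) (hahn R n j.+1).
Proof.
move=> lekn; pose g y := (bl_law R k t x (inord y) - bl_stationary R (inord y : 'I_n.+1)) / bl_weight R n y.
transitivity (bl_dot n g g).
  apply: eq_bigr => y _; rewrite /g inord_val.
  have : bl_weight R n y != 0 by rewrite gt_eqF // bl_weight_gt0 // -ltnS.
  by move=> w0; field.
have dotg j : bl_dot n (hahn R n j) g =
    \sum_(y < n.+1) bl_law R k t x y * hahn R n j y - bl_dot n (hahn R n j) (hahn R n 0) / 'C(2 * n, n)%:R.
  rewrite mulr_suml -sumrB; apply: eq_bigr => y _.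
  rewrite /g inord_val bl_stationaryE hahn0.
  have : bl_weight R n y != 0 by rewrite gt_eqF // bl_weight_gt0 // -ltnS.
  have : 'C(2 * n, n)%:R != 0 :> R by rewrite pnatr_eq0 -lt0n bin_gt0 leq_pmull.
  by move=> ? ?; field; apply/andP.
have S0 : 'C(2 * n, n)%:R != 0 :> R by rewrite pnatr_eq0 -lt0n bin_gt0 leq_pmull.
rewrite hahn_parseval big_ord_recl.
have -> : bl_dot n (hahn R n (ord0 : 'I_n.+1)) g = 0.
  rewrite dotg bl_law_hahn // !hahn0 expr1n mulr1.
  have -> : bl_dot n (hahn R n 0) (hahn R n 0) = 'C(2 * n, n)%:R.
    by rewrite -bl_weight_sum; apply: eq_bigr => y _; rewrite hahn0 !mulr1.
  by rewrite divff // subrr.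
rewrite expr0n mul0r add0r; apply: eq_bigr => j _; rewrite lift0 dotg bl_law_hahn //.
by rewrite hahn_dot_neq // mul0r subr0.
Qed.

End Spectrum.

(** * Exact norms of the Hahn polynomials *)

Lemma ffact_le_exp n m : (n ^_ m <= n ^ m)%N.
Proof.
by elim: m => // m IHm; rewrite ffactnSr expnSr leq_mul // leq_subr.
Qed.

Section HahnNorm.
Variables (R : realType) (n j : nat).
Hypothesis lejn : (j <= n)%N.

Let u l := bl_dot n (hahn R n j) (fun x => 'C(x, l)%:R).

(** The defining recurrence multiplied out, with factorials on both sides to avoid quotients and
    absolute values to avoid tracking signs. *)
Lemma abs_hahn_coef i : (i <= j)%N ->
  `|hahn_coef R n j i| * (n`! ^ 2 * (j - i)`! * (2 * n + 1 - j - i)`!)%:R =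
  ((n - i)`! ^ 2 * j`! * (2 * n + 1 - j)`!)%:R.
Proof.
elim: i => [|i IHi] lt; first by rewrite /= normr1 mul1r !subn0; congr _%:R; ring.
have ltin : (i < n)%N by lia.
have n0 : ((n - i) ^ 2)%:R != 0 :> R by rewrite pnatr_eq0 expn_eq0 andbT subn_eq0 -ltnNge.
apply: (mulfI n0).
have E : ((n - i) ^ 2)%:R * `|hahn_coef R n j i.+1| =
    `|hahn_coef R n j i| * ((j - i) * (2 * n + 1 - j - i))%:R.
  have := congr1 Num.norm (hahn_coefS R j ltin); rewrite hahn_eigB normrM normrX !normrM.
  have -> : `|n%:R - i%:R| = (n - i)%:R :> R by rewrite -natrB 1?ltnW // normr_nat.
  have -> : `|i%:R - j%:R| = (j - i)%:R :> R by rewrite distrC -natrB 1?ltnW // normr_nat.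
  have -> : 2 * n%:R + 1 - i%:R - j%:R = (2 * n + 1 - j - i)%:R :> R.
    by rewrite !natrB ?natrD ?natrM //; [ring | lia | lia].
  by rewrite normr_nat natrX natrM.
have E1 : ((j - i)`! = (j - i) * (j - i.+1)`!)%N.
  by rewrite (_ : j - i = (j - i.+1).+1)%N ?factS //; lia.
have E2 : ((2 * n + 1 - j - i)`! = (2 * n + 1 - j - i) * (2 * n + 1 - j - i.+1)`!)%N.
  by rewrite (_ : 2 * n + 1 - j - i = (2 * n + 1 - j - i.+1).+1)%N ?factS //; lia.
have E3 : ((n - i)`! = (n - i) * (n - i.+1)`!)%N.
  by rewrite (_ : n - i = (n - i.+1).+1)%N ?factS //; lia.
rewrite mulrA E -natrM.
have -> : ((n - i) ^ 2 * ((n - i.+1)`! ^ 2 * j`! * (2 * n + 1 - j)`!) =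
  (n - i)`! ^ 2 * j`! * (2 * n + 1 - j)`!)%N by rewrite E3; ring.
rewrite -(IHi (ltnW lt)) -mulrA -natrM E1 E2; congr (_ * _%:R); ring.
Qed.

(** Downward induction from l = n, where C(x, n) charges only x = n and f_j(n)^2 = 1; m is the
    distance n - l. *)
Lemma abs_hahn_dot_bin m : (m <= n - j)%N ->
  `|u (n - m)%N| * (m`! ^ 2 * (n - m - j)`!)%:R = (n + m - j)`!%:R.
Proof.
elim: m => [|m IHm] lt.
  rewrite fact0 exp1n mul1n subn0 addn0 /u /bl_dot big_ord_recr big1 ?add0r /= => [|x _].
    have := hahn_at_max_sqr R lejn; move/(congr1 Num.norm).
    rewrite normrX normr1 => /eqP; rewrite sqrp_eq1 // => /eqP Hn.
    by rewrite add0r /bl_weight binn expr1n !mulr1 !mul1r Hn mul1r.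
  by rewrite (bin_small (ltn_ord x)) mulr0.
have m0 : (m.+1 ^ 2)%:R != 0 :> R by rewrite pnatr_eq0.
have E : `|u (n - m.+1)%N| * (m.+1 ^ 2)%:R = `|u (n - m)%N| * ((n - m - j) * (n + m.+1 - j))%:R.
  have := hahn_dot_bin_step R (n - m.+1)%N lejn; rewrite -/(u _) (_ : (n - m.+1).+1 = n - m)%N; last by lia.
  rewrite -/(u _) hahn_eigB => /(congr1 Num.norm); rewrite normrM [in RHS]normrM normrX !normrM.
  have -> : `|n%:R - (n - m.+1)%:R| = m.+1%:R :> R.
    by rewrite -natrB ?leq_subr // normr_nat subKn //; lia.
  have -> : `|(n - m)%:R - j%:R| = (n - m - j)%:R :> R by rewrite -natrB ?normr_nat //; lia.
  have -> : 2 * n%:R + 1 - (n - m)%:R - j%:R = (n + m.+1 - j)%:R :> R.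
    by rewrite !natrB ?natrD -?natr1 //; [ring | lia | lia].
  by rewrite normr_nat -natrM -natrX => H; rewrite [LHS]mulrC -H mulrC.
have E1 : ((n - m - j)`! = (n - m - j) * (n - m.+1 - j)`!)%N.
  by rewrite (_ : n - m - j = (n - m.+1 - j).+1)%N ?factS //; lia.
have E2 : ((n + m.+1 - j)`! = (n + m.+1 - j) * (n + m - j)`!)%N.
  by rewrite (_ : n + m.+1 - j = (n + m - j).+1)%N ?factS //; lia.
have -> : (m.+1`! ^ 2 * (n - m.+1 - j)`! = m.+1 ^ 2 * (m`! ^ 2 * (n - m.+1 - j)`!))%N.
  by rewrite factS; ring.
rewrite natrM mulrA E E2 !natrM -(IHm (ltnW lt)) E1 !natrM; ring.
Qed.

(** Once one factor is expanded in binomials, orthogonality leaves only its leading term: the norm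
    is the leading coefficient times the j-th binomial moment. Its positivity allows absolute
    values. *)
Lemma hahn_dot_self :
  bl_dot n (hahn R n j) (hahn R n j) * (n`! ^ 2 * (2 * n + 1 - 2 * j))%:R =
  (j`! * (2 * n + 1 - j)`!)%:R.
Proof.
have -> : bl_dot n (hahn R n j) (hahn R n j) = `|hahn_coef R n j j| * `|u j|.
  rewrite -normrM -[LHS]ger0_norm ?ltW ?hahn_dot_gt0 //; congr `|_|.
  rewrite (bl_dot_sum _ _ _ (fun i x => hahn_coef R n j i * 'C(x, i)%:R)).
  rewrite (bigD1 (Ordinal (lejn : (j < n.+1)%N))) //= bl_dotZ big1 ?addr0 // => i nij.
  rewrite bl_dotZ; have [ltji|] := ltnP j i; first by rewrite hahn_coef_eq0 // mul0r.
  rewrite leq_eqVlt => /predU1P[eij|ltij]; last by rewrite hahn_dot_bin ?mulr0 // ltij.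
  by case/eqP: nij; apply: val_inj.
have := abs_hahn_dot_bin (leqnn (n - j)); rewrite subKn // subnn fact0 muln1.
rewrite (_ : n + (n - j) - j = 2 * n - 2 * j)%N; last by lia.
have := abs_hahn_coef (leqnn j); rewrite subnn fact0 muln1.
rewrite (_ : 2 * n + 1 - j - j = (2 * n - 2 * j).+1)%N; last by lia.
rewrite (_ : 2 * n + 1 - 2 * j = (2 * n - 2 * j).+1)%N; last by lia.
rewrite factS => E1 E2.
have q0 : ((2 * n - 2 * j)`! * (n - j)`! ^ 2)%:R != 0 :> R.
  by rewrite pnatr_eq0 muln_eq0 expn_eq0 negb_or !negb_and -!lt0n !fact_gt0.
apply: (mulIf q0).
transitivity ((`|hahn_coef R n j j| * (n`! ^ 2 * ((2 * n - 2 * j).+1 * (2 * n - 2 * j)`!))%:R) *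
   (`|u j| * ((n - j)`! ^ 2)%:R)); first by rewrite !natrM; ring.
by rewrite E1 E2 !natrM; ring.
Qed.

(* The ratio is the dimension of an irreducible component of the action of the
   symmetric group S_2n on n-sets. *)
Lemma hahn_norm_bound :
  'C(2 * n, n)%:R / bl_dot n (hahn R n j) (hahn R n j) <= (2 * n + 1)%:R ^+ j.
Proof.
rewrite ler_pdivrMr ?hahn_dot_gt0 //.
have q0 : 0 < (n`! ^ 2 * (2 * n + 1 - 2 * j))%:R :> R.
  by rewrite ltr0n muln_gt0 expn_gt0 fact_gt0 /=; lia.
rewrite -(ler_pM2r q0) -mulrA hahn_dot_self -natrX -!natrM ler_nat.
have -> : ('C(2 * n, n) * (n`! ^ 2 * (2 * n + 1 - 2 * j)) = (2 * n)`! * (2 * n + 1 - 2 * j))%N.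
  have len : (n <= 2 * n)%N by lia.
  by rewrite -[in RHS](bin_fact len) mulnA (_ : 2 * n - n = n)%N ?mulnn //; lia.
have lej : (j <= 2 * n + 1)%N by lia.
(* (2n+1)! splits into j descending factors, each at most 2n+1, and (2n+1-j)!. *)
apply: leq_trans (_ : (2 * n + 1)`! <= _)%N.
  by rewrite {2}addn1 factS addn1 mulnC leq_mul // leq_subr.
rewrite -(ffact_fact lej); apply: leq_mul; first exact: ffact_le_exp.
by rewrite leq_pmull // fact_gt0.
Qed.

End HahnNorm.

(** * Decay of the eigenvalues *)

Section EigenvalueBound.
Variables (R : realFieldType) (f : nat -> R) (M N : R) (k : nat).
Hypotheses (N0 : 0 < N) (leMN : M <= N ^+ 2) (kN : 256 * k%:R <= N) (f0 : f 0 = 1).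
Hypothesis f_rec : forall x, (N - x%:R) ^+ 2 * f x.+1 =
  (M - 2 * N * x%:R + 2 * x%:R ^+ 2) * f x - x%:R ^+ 2 * f x.-1.

(** The two ratio bounds sustain each other. The lower one keeps f positive and makes the subtracted
    term x^2 f(x-1) small against M f(x) at the next step; the upper one, with M <= N^2, gives f(x)
    <= f(x-1), so that the subtraction cancels one of the two x^2 f(x). *)
Lemma rec_geometric_decay x : 8 * k%:R * N <= M -> (0 < k)%N -> (x < k)%N ->
  [/\ 0 < f x, M * f x <= 2 * N ^+ 2 * f x.+1 & N ^+ 2 * f x.+1 <= M * f x].
Proof.
move=> kM k0; have k1 : 1 <= k%:R :> R by rewrite ler1n.
have M0 : 0 < M by apply: lt_le_trans kM; rewrite !mulr_gt0 //; lra.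
elim: x => [|x IHx] ltxk.
  have := f_rec 0; rewrite f0 expr0n mul0r !mulr0 !subr0 !addr0 => E.
  by rewrite -mulrA E; split => //; lra.
have [F0 lo up] := IHx (ltnW ltxk).
have xk : x.+1%:R <= k%:R :> R by rewrite ler_nat ltnW.
have x0 : 0 < x.+1%:R :> R by rewrite ltr0n.
have := f_rec x.+1; rewrite [x.+1.-1]/=.
move: (x.+1%:R) xk x0 => y yk y0; move: (f x.+2) (f x.+1) (f x) F0 lo up => H F G G0 lo up rec.
have F0 : 0 < F.
  have : 0 < 2 * N ^+ 2 * F by apply: lt_le_trans lo; rewrite mulr_gt0.
  by rewrite pmulr_rgt0 // mulr_gt0 // exprn_gt0.
have yN : 256 * y <= N by apply: le_trans kN; rewrite ler_pM2l.
have yNM : 8 * (y * N) <= M.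
  by apply: le_trans kM; rewrite mulrA ler_pM2r // ler_pM2l.
have FG : F <= G.
  rewrite -(ler_pM2l (exprn_gt0 2 N0)); apply: le_trans up _.
  by rewrite ler_pM2r.
have d0 : 0 < (N - y) ^+ 2 by apply: exprn_gt0; lra.
split => //.
  have lo2 : y ^+ 2 * G <= M / 32 * F.
    rewrite -(ler_pM2l M0); apply: (@le_trans _ _ (2 * (y * N) ^+ 2 * F)).
      rewrite (_ : M * _ = y ^+ 2 * (M * G)); last by ring.
      rewrite (_ : 2 * _ * F = y ^+ 2 * (2 * N ^+ 2 * F)); last by ring.
      by rewrite ler_pM2l // exprn_gt0.
    rewrite (_ : M * (M / 32 * F) = (M ^+ 2 / 32) * F); last by field.
    rewrite ler_pM2r //.
    have : (8 * (y * N)) ^+ 2 <= M ^+ 2.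
      apply: lerXn2r => //; rewrite ?nnegrE; last exact: ltW.
      by rewrite mulr_ge0 // mulr_ge0 // ltW.
    by rewrite exprMn; lra.
  have lo3 : M / 2 * F <= (N - y) ^+ 2 * H.
    rewrite rec; have : M / 4 * F - 2 * N * y * F >= 0.
      by rewrite -mulrBl; apply: mulr_ge0; [lra | exact: ltW].
    have : 0 <= y ^+ 2 * F by rewrite mulr_ge0 ?sqr_ge0 // ltW.
    by have : 0 < M * F by [exact: mulr_gt0]; lra.
  have H0 : 0 < H by rewrite -(pmulr_rgt0 _ d0); apply: lt_le_trans lo3; rewrite mulr_gt0 // divr_gt0.
  have : (N - y) ^+ 2 * H <= N ^+ 2 * H by rewrite ler_pM2r // ler_sqr ?nnegrE; lra.
  lra.
rewrite -(ler_pM2l d0) mulrCA rec.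
have : (M - 2 * N * y + 2 * y ^+ 2) * F - y ^+ 2 * G <= (M - 2 * N * y + y ^+ 2) * F.
  have : y ^+ 2 * F <= y ^+ 2 * G by rewrite ler_pM2l // exprn_gt0.
  lra.
move=> /(ler_wpM2l (sqr_ge0 N)) h; apply: le_trans h _.
rewrite !mulrA ler_pM2r // -subr_ge0.
rewrite (_ : _ - _ = y * (2 * N - y) * (N ^+ 2 - M)); last by ring.
by rewrite !mulr_ge0 ?subr_ge0 // ?(ltW y0) //; lra.
Qed.

(** The coefficient of f(x) may have either sign, so only the triangle inequality is used. That
    coefficient is at most 10kN in absolute value and x^2 <= k^2; with ratio 16k/N the right side
    costs 160 + 1 = 161 times k^2, against 0.99 times 256 on the left. *)
Lemma rec_superexp_decay x : - (k%:R * N) <= M -> M <= 8 * k%:R * N -> (0 < k)%N ->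
  (x <= k)%N -> N ^+ x * `|f x| <= (16 * k%:R) ^+ x.
Proof.
move=> lM uM k0; have k1 : 1 <= k%:R :> R by rewrite ler1n.
have e0 : 0 < 16 * k%:R :> R by lra.
have base : `|M| <= 8 * k%:R * N.
  by rewrite ler_norml uM andbT; have : 0 < k%:R * N by [rewrite mulr_gt0 //; lra]; lra.
elim/ltn_ind: x => -[|[|x]] IH lex.
- by rewrite f0 normr1 !expr0 mul1r.
- have := f_rec 0; rewrite f0 expr0n mul0r !mulr0 !subr0 !addr0 mulr1 => E.
  rewrite !expr1 -(ler_pM2l N0) mulrA -expr2 -(ger0_norm (sqr_ge0 N)) -normrM E.
  by apply: le_trans base _; have : 0 < k%:R * N by [rewrite mulr_gt0 //; lra]; lra.
have := IH x.+1 (ltnSn _) (ltnW lex); have := IH x (ltnW (ltnSn _)) (ltnW (ltnW lex)).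
have xk : x.+1%:R <= k%:R :> R by rewrite ler_nat ltnW.
have x0 : 0 < x.+1%:R :> R by rewrite ltr0n.
rewrite !exprS; have := f_rec x.+1; rewrite [x.+1.-1]/=.
move: (x.+1%:R) xk x0 => y yk y0; move: (f x.+2) (f x.+1) (f x) => H F G rec.
have P0 : 0 < N ^+ x by rewrite exprn_gt0.
have Q0 : 0 < (16 * k%:R) ^+ x :> R by rewrite exprn_gt0.
move: (N ^+ x) ((16 * k%:R) ^+ x) P0 Q0 => P Q P0 Q0 hG hF.
have N1 := N0; have kN1 := kN; set K : R := k%:R in k1 yk kN1 uM lM hF hG base e0 *.
have d0 : 0 < (N - y) ^+ 2 by apply: exprn_gt0; lra.
have dlow : 99 / 100 * N ^+ 2 <= (N - y) ^+ 2.
  by have : 0 <= N * (N - 256 * y) by [rewrite mulr_ge0; lra]; have := sqr_ge0 y; lra.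
have A1 : `|M - 2 * N * y + 2 * y ^+ 2| <= 10 * K * N.
  have p1 : 0 <= y * (N - y) by rewrite mulr_ge0; lra.
  have p2 : y * N <= K * N by rewrite ler_pM2r.
  have p3 : 0 < K * N by rewrite mulr_gt0 //; lra.
  have p4 : 0 <= y ^+ 2 by exact: sqr_ge0.
  by rewrite ler_norml; apply/andP; split; lra.
have A2 : (N - y) ^+ 2 * `|H| <= 10 * K * N * `|F| + K ^+ 2 * `|G|.
  rewrite -[(N - y) ^+ 2]ger0_norm ?sqr_ge0 // -normrM rec.
  apply: le_trans (ler_normB _ _) _; apply: lerD; rewrite normrM; first exact: ler_wpM2r.
  by rewrite ler_wpM2r // normrX (gtr0_norm y0) lerXn2r ?nnegrE //; lra.
have A3 : N ^+ 2 * ((N - y) ^+ 2 * (P * `|H|)) <= N ^+ 2 * (161 * K ^+ 2 * Q).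
  have h1 : N ^+ 2 * (10 * K) * (N * P * `|F|) <= N ^+ 2 * (10 * K) * (16 * K * Q).
    by rewrite ler_wpM2l // mulr_ge0 ?sqr_ge0 //; lra.
  have h2 : N ^+ 2 * K ^+ 2 * (P * `|G|) <= N ^+ 2 * K ^+ 2 * Q.
    by rewrite ler_wpM2l // mulr_ge0 ?sqr_ge0.
  have h3 : N ^+ 2 * P * ((N - y) ^+ 2 * `|H|) <= N ^+ 2 * P * (10 * K * N * `|F| + K ^+ 2 * `|G|).
    by rewrite ler_wpM2l // mulr_ge0 ?sqr_ge0 // ltW.
  lra.
rewrite ler_pM2l ?exprn_gt0 // in A3.
have A4 : 99 / 100 * N ^+ 2 * (P * `|H|) <= (N - y) ^+ 2 * (P * `|H|).
  by rewrite ler_wpM2r // mulr_ge0 // ltW.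
have A5 : 0 <= K ^+ 2 * Q by rewrite mulr_ge0 ?sqr_ge0 // ltW.
lra.
Qed.

End EigenvalueBound.

Lemma hahn_eigenvalue_bound (R : realType) (n j k : nat) :
  (0 < k)%N -> (256 * k <= n)%N -> (j <= n)%N ->
  `|hahn R n j k| <= expR (- (2 * j%:R * k%:R / n%:R)).
Proof.
move=> k0 kn lejn; have n0 : (0 < n)%N by lia.
have N0 : 0 < n%:R :> R by rewrite ltr0n.
have jN : j%:R <= n%:R :> R by rewrite ler_nat.
have j0 : 0 <= j%:R :> R by [].
have k1 : 1 <= k%:R :> R by rewrite ler1n.
have kN : 256 * k%:R <= n%:R :> R by rewrite -natrM ler_nat.
(* This is n^2 - j(2n+1-j), which puts the eigenvalue equation into the form [f_rec]. *)
pose M : R := (n%:R - j%:R) ^+ 2 - j%:R.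
have rec x : (n%:R - x%:R) ^+ 2 * hahn R n j x.+1 =
    (M - 2 * n%:R * x%:R + 2 * x%:R ^+ 2) * hahn R n j x - x%:R ^+ 2 * hahn R n j x.-1.
  have := bl_gen_hahn R x lejn; rewrite /bl_gen /hahn_eig /M => E.
  move: E; move: (hahn R n j x.+1) (hahn R n j x) (hahn R n j x.-1) => H F G E.
  by apply/eqP; rewrite -subr_eq0 -[X in _ == X](subrr (- (j%:R * (2 * n%:R + 1 - j%:R)) * F)) -{1}E; apply/eqP; ring.
have leM : M <= (n%:R - j%:R) ^+ 2 by rewrite /M; lra.
have leMN : M <= n%:R ^+ 2.
  by apply: le_trans leM _; rewrite ler_sqr ?nnegrE //; lra.
have [geM|ltM] := leP (8 * k%:R * n%:R) M.
  have decay x : (x <= k)%N -> 0 < hahn R n j x /\ n%:R ^+ 2 ^+ x * hahn R n j x <= M ^+ x.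
    elim: x => [_|x IHx ltxk]; first by rewrite hahn_at0 !expr0 mul1r.
    have [_ le] := IHx (ltnW ltxk).
    have [F0 lo up] := rec_geometric_decay N0 leMN kN (hahn_at0 _ _ _) rec geM k0 ltxk.
    have M0 : 0 < M by apply: lt_le_trans geM; rewrite !mulr_gt0 //; lra.
    split.
      have : 0 < 2 * n%:R ^+ 2 * hahn R n j x.+1 by apply: lt_le_trans lo; rewrite mulr_gt0.
      by rewrite pmulr_rgt0 // mulr_gt0 // exprn_gt0.
    rewrite [_ ^+ 2 ^+ _]exprSr [M ^+ _]exprSr -mulrA.
    apply: le_trans (ler_wpM2l _ up) _; first by rewrite !exprn_ge0 // ltW.
    by rewrite mulrCA [leRHS]mulrC ler_pM2l.
  have [F0 le] := decay k (leqnn k); rewrite gtr0_norm //.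
  have {}le : hahn R n j k <= (M / n%:R ^+ 2) ^+ k.
    by rewrite expr_div_n ler_pdivlMr ?exprn_gt0 // mulrC.
  apply: le_trans le _.
  have q0 : 0 <= M / n%:R ^+ 2.
    by rewrite divr_ge0 ?sqr_ge0 //; apply: le_trans geM; rewrite !mulr_ge0 //; lra.
  rewrite (_ : - _ = k%:R * (2%:R * - (j%:R / n%:R))); last first.
    by field; rewrite gt_eqF.
  rewrite expRM_natl; apply: lerXn2r; rewrite ?nnegrE ?expR_ge0 //.
  rewrite expRM_natl ler_pdivrMr ?exprn_gt0 //; apply: le_trans leM _.
  rewrite -exprMn; apply: lerXn2r; rewrite ?nnegrE ?mulr_ge0 ?expR_ge0 //; first lra.
  rewrite -ler_pdivrMr //; apply: le_trans (expR_ge1Dx _).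
  by rewrite mulrBl divff // gt_eqF.
(* M can be negative when j is close to n, but M >= -j >= -n. *)
have lM : - (k%:R * n%:R) <= M.
  have : n%:R <= k%:R * n%:R :> R by rewrite ler_peMl // ltW.
  by have := sqr_ge0 (n%:R - j%:R : R); rewrite /M; lra.
have := rec_superexp_decay N0 kN (hahn_at0 _ _ _) rec lM (ltW ltM) k0 (leqnn k).
rewrite mulrC -ler_pdivlMr ?exprn_gt0 // -expr_div_n => le; apply: le_trans le _.
apply: (@le_trans _ _ (expR (k%:R * - 2))); last first.
  rewrite ler_expR mulrN lerN2 ler_pdivrMr //.
  by have : j%:R * k%:R <= n%:R * k%:R :> R by [rewrite ler_wpM2r]; lra.
rewrite expRM_natl; apply: lerXn2r; rewrite ?nnegrE ?expR_ge0 ?divr_ge0 ?mulr_ge0 //.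
rewrite ler_pdivrMr //.
(* The fourth power of exp(-1/2) >= 1/2. *)
have : 16^-1 <= expR (- 2) :> R.
  rewrite (_ : - 2 = 4%:R * - 2^-1); last by field.
  rewrite expRM_natl (_ : 16^-1 = 2^-1 ^+ 4); last by field.
  apply: lerXn2r; rewrite ?nnegrE ?expR_ge0 ?invr_ge0 //.
  by apply: le_trans (expR_ge1Dx _); lra.
move=> /(ler_wpM2r (ltW N0)); lra.
Qed.

(** * From chi-square to total variation *)

(** For S > 0 the difference of the two sides is S times the w-weighted sum of the squares of |d|/w
    - T/S. *)
Lemma cauchy_schwarz_weighted (R : realFieldType) (I : finType) (w d : I -> R) :
  (forall i, 0 < w i) ->
  (\sum_i `|d i|) ^+ 2 <= (\sum_i w i) * \sum_i d i ^+ 2 / w i.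
Proof.
move=> w0; set S := \sum_i w i; set T := \sum_i `|d i|; set Q := \sum_i _.
have S0 : 0 <= S by apply: sumr_ge0 => i _; exact: ltW.
have [S00|Sn0] := eqVneq S 0.
  rewrite S00 mul0r /T big1 ?expr0n // => i _.
  by have := psumr_eq0P (fun i _ => ltW (w0 i)) S00 (isT : xpredT i) => wi0; have := w0 i; rewrite wi0 ltxx.
have Sp : 0 < S by rewrite lt_neqAle eq_sym Sn0.
have : 0 <= \sum_i (`|d i| / w i - T / S) ^+ 2 * w i.
  by apply: sumr_ge0 => i _; rewrite mulr_ge0 ?sqr_ge0 // ltW.
have -> : \sum_i (`|d i| / w i - T / S) ^+ 2 * w i =
    \sum_i (d i ^+ 2 / w i - (2 * T / S) * `|d i| + (T / S) ^+ 2 * w i).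
  apply: eq_bigr => i _; have wn : w i != 0 by rewrite gt_eqF.
  by rewrite -[d i ^+ 2](real_normK (num_real _)); field; apply/andP.
rewrite big_split sumrB -!mulr_sumr -/Q -/S -/T /= => h.
rewrite -subr_ge0 (_ : _ - _ = S * (Q - 2 * T / S * T + (T / S) ^+ 2 * S)); last by field.
exact: mulr_ge0.
Qed.

Lemma geometric_sum_le (R : realFieldType) (r : R) (n : nat) : 0 <= r <= 2^-1 ->
  \sum_(i < n) r ^+ i.+1 <= 2 * r.
Proof.
(* The bound 2r alone is not inductive; with the factor 1 - r^n the step reduces to 2r <= 1. *)
move=> /andP[r0 r1]; suff : \sum_(i < n) r ^+ i.+1 <= 2 * r * (1 - r ^+ n).
  by move=> h; apply: le_trans h _; rewrite ler_piMr ?mulr_ge0 // gerBl exprn_ge0.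
elim: n => [|n IHn]; first by rewrite big_ord0 expr0 subrr mulr0.
rewrite big_ord_recr /= exprS; apply: le_trans (lerD IHn (lexx _)) _.
have : 0 <= r * r ^+ n * (1 - 2 * r) by rewrite !mulr_ge0 ?exprn_ge0 //; lra.
lra.
Qed.

Lemma bl_tv_bound (R : realType) (n k t : nat) (x : 'I_n.+1) (r : R) :
  (0 < k)%N -> (256 * k <= n)%N ->
  r = (2 * n + 1)%:R * expR (- (4 * k%:R * t%:R / n%:R)) -> r <= 2^-1 ->
  (2 * tv_dist (bl_law R k t x) (@bl_stationary R n)) ^+ 2 <= 2 * r.
Proof.
move=> k0 kn rE r1; have lekn : (k <= n)%N by lia.
have n0 : n%:R != 0 :> R by rewrite pnatr_eq0; lia.
have r0 : 0 <= r by rewrite rE mulr_ge0 ?expR_ge0.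
rewrite /tv_dist mulrA divff // mul1r.
apply: le_trans (cauchy_schwarz_weighted (w := fun y : 'I_n.+1 => bl_weight R n y) _ _) _.
  by move=> y; rewrite bl_weight_gt0 // -ltnS.
rewrite bl_weight_sum bl_law_chi2 // mulr_sumr.
apply: le_trans (geometric_sum_le n (_ : 0 <= r <= 2^-1)); last by rewrite r0.
apply: ler_sum => j _; rewrite mulrCA mulrC rE [leRHS]exprMn.
have jn : (j.+1 <= n)%N by [].
apply: ler_pM; first by rewrite divr_ge0 // ltW // hahn_dot_gt0.
- exact: sqr_ge0.
- exact: hahn_norm_bound.
(* Squaring doubles the exponent 2jkt/n; this is the 4 in [r], and finally the 1/4 in front of n log
   n / k. *)
have -> : expR (- (4 * k%:R * t%:R / n%:R)) ^+ j.+1 =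
    (expR (- (2 * j.+1%:R * k%:R / n%:R)) ^+ t) ^+ 2 :> R.
  by rewrite -!expRM_natl; congr expR; field.
rewrite -real_normK ?num_real // lerXn2r ?nnegrE ?exprn_ge0 ?expR_ge0 // normrM normrX.
rewrite -[leRHS]mulr1; apply: ler_pM; rewrite ?exprn_ge0 //.
  by rewrite lerXn2r ?nnegrE ?expR_ge0 // hahn_eigenvalue_bound.
by rewrite hahn_abs_le1 // -ltnS.
Qed.

(** * The mixing time *)

Lemma bl_mixing_time_le (R : realType) (n k t : nat) (eps : R) :
  bl_worst_tv R n k t <= eps -> (bl_mixing_time n k eps <= t%:R%:E)%E.
Proof.
move=> le; rewrite /bl_mixing_time; case: pselect => [ex|]; last by case; exists t.
by rewrite lee_fin ler_nat; case: ex_minnP => m _; apply.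
Qed.

Lemma bl_worst_tv_le (R : realType) (n k t : nat) (eps : R) : 0 < eps < 1 ->
  (0 < k)%N -> (256 * k <= n)%N ->
  n%:R / (4 * k%:R) * ln n%:R + 2 * n%:R / (eps ^+ 4 * k%:R) <= t%:R ->
  bl_worst_tv R n k t <= eps.
Proof.
move=> /andP[e0 e1] k0 kn let_.
have n1 : (0 < n)%N by lia.
have N0 : 0 < n%:R :> R by rewrite ltr0n.
have N1 : 1 <= n%:R :> R by rewrite ler1n.
have K0 : 0 < k%:R :> R by rewrite ltr0n.
have e40 : 0 < eps ^+ 4 by rewrite exprn_gt0.
pose r : R := (2 * n + 1)%:R * expR (- (4 * k%:R * t%:R / n%:R)).
(* The surplus 2n/(eps^4 k) in t becomes 8/eps^4 in the exponent, which exp(u) >= u turns into a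
   factor eps^4/8; the 3 bounds (2n+1)/n. *)
have re : r <= 3 / 8 * eps ^+ 4.
  have h : ln n%:R + 8 / eps ^+ 4 <= 4 * k%:R * t%:R / n%:R :> R.
    have c0 : 0 < 4 * k%:R / n%:R :> R by rewrite divr_gt0 // mulr_gt0.
    have := ler_wpM2l (ltW c0) let_; congr (_ <= _); last by field; rewrite gt_eqF.
    by field; rewrite !gt_eqF.
  have h2 : expR (- (4 * k%:R * t%:R / n%:R)) <= n%:R^-1 * (eps ^+ 4 / 8) :> R.
    apply: (@le_trans _ _ (expR (- (ln n%:R + 8 / eps ^+ 4)))); first by rewrite ler_expR lerN2.
    rewrite opprD expRD expRN lnK ?posrE // ler_pM2l ?invr_gt0 //.
    rewrite expRN -[leRHS]invrK lef_pV2 ?posrE ?expR_gt0 ?invr_gt0 ?divr_gt0 //.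
    rewrite invf_div; apply: le_trans (expR_ge1Dx _); lra.
  apply: (@le_trans _ _ ((2 * n + 1)%:R * (n%:R^-1 * (eps ^+ 4 / 8)))); first by rewrite ler_wpM2l.
  rewrite mulrA (_ : 3 / 8 * eps ^+ 4 = 3 * (eps ^+ 4 / 8)); last by field.
  rewrite ler_pM2r ?divr_gt0 // ler_pdivrMr // natrD natrM; lra.
have e21 : eps ^+ 2 <= 1 by rewrite exprn_ile1 // ltW.
have e20 : 0 < eps ^+ 2 by rewrite exprn_gt0.
have e42 : eps ^+ 4 <= eps ^+ 2 by rewrite (exprD _ 2 2) ler_piMr // ltW.
have r1 : r <= 2^-1 by lra.
apply/bigmax_leP; split=> [|x _]; first exact: ltW.
have tv0 : 0 <= tv_dist (bl_law R k t x) (@bl_stationary R n).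
  by rewrite mulr_ge0 ?invr_ge0 // sumr_ge0.
have tv20 := mulr_ge0 (ler0n R 2) tv0; have eps20 := mulr_ge0 (ler0n R 2) (ltW e0).
rewrite -(ler_pM2l (ltr0Sn R 1)) -ler_sqr //.
apply: le_trans (@bl_tv_bound R n k t x r k0 kn erefl r1) _.
by rewrite exprMn; lra.
Qed.

Local Open Scope classical_set_scope.

Theorem theorem1 (R : realType) :
  exists C : R, 0 < C /\
  forall k : nat -> nat,
    (forall n : nat, (0 < n)%N -> (1 <= k n <= n)%N) ->
    (fun n : nat => (k n)%:R : R) =o_\oo (fun n : nat => n%:R : R) ->
    forall eps : R, 0 < eps < 1 ->
    exists n0 : nat, forall n : nat, (n0 <= n)%N ->
      (bl_mixing_time n (k n) eps <=
        (n%:R / (4 * (k n)%:R) * ln n%:R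
         + 3 * n%:R / (k n)%:R * ln (ln n%:R)
         + C * n%:R / (eps ^+ 4 * (k n)%:R))%:E)%E.
Proof.
(* Two units come from [bl_worst_tv_le]; the third pays for rounding the time up to an integer, as
   n/(eps^4 k) >= 1. *)
exists 3; split => // k kn /eqoP ko eps eps01; have /andP[e0 e1] := eps01.
have c0 : 0 < 256^-1 :> R by rewrite invr_gt0.
(* k = o(n) with constant 1/256 gives 256k <= n, and n >= 4 > e gives log n >= 1, so that log log n
   >= 0. *)
have [n0 _ n0P] := ko _ c0; exists (maxn n0 4) => n; rewrite geq_max => /andP[len0 le4].
have n1 : (0 < n)%N by lia.
have /andP[k1 lekn] := kn n n1.
have k256 : (256 * k n <= n)%N.
  have := n0P n len0; rewrite /= !normr_nat mulrC ler_pdivlMr // -natrM ler_nat; lia.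
have N4 : 4 <= n%:R :> R by rewrite ler_nat.
have K0 : 0 < (k n)%:R :> R by rewrite ltr0n.
have Kn : (k n)%:R <= n%:R :> R by rewrite ler_nat.
have ln1 : 1 <= ln n%:R :> R.
  rewrite -ler_expR lnK ?posrE; last by apply: lt_le_trans N4.
  (* e <= 4 follows by squaring exp(-1/2) >= 1/2. *)
  apply: le_trans N4; have half : 2^-1 <= expR (- 2^-1) :> R.
    by apply: le_trans (expR_ge1Dx _); lra.
  rewrite [X in expR X](_ : 1 = - (2%:R * - 2^-1)); last by field.
  rewrite expRN expRM_natl -[leRHS]invrK lef_pV2 ?posrE ?exprn_gt0 ?expR_gt0 ?invr_gt0 //.
  rewrite (_ : 4^-1 = 2^-1 ^+ 2); last by field.
  by rewrite lerXn2r ?nnegrE ?expR_ge0 ?invr_ge0.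
have e40 : 0 < eps ^+ 4 by rewrite exprn_gt0.
have e41 : eps ^+ 4 <= 1 by rewrite exprn_ile1 // ltW.
pose T : R := n%:R / (4 * (k n)%:R) * ln n%:R + 2 * n%:R / (eps ^+ 4 * (k n)%:R).
have T0 : 0 <= T.
  by rewrite addr_ge0 // ?mulr_ge0 ?invr_ge0 ?mulr_ge0 ?(ltW e40) ?(ltW K0) //; lra.
apply: le_trans (bl_mixing_time_le (bl_worst_tv_le eps01 k1 k256 (ltW (truncnS_gt T)))) _.
rewrite lee_fin -natr1; have /andP[Tle _] := truncn_itv T0.
have loglog : 0 <= 3 * n%:R / (k n)%:R * ln (ln n%:R) :> R.
  by rewrite mulr_ge0 ?ln_ge0 // divr_ge0.
have last : 1 <= n%:R / (eps ^+ 4 * (k n)%:R) :> R.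
  rewrite ler_pdivlMr ?mulr_gt0 // mul1r; apply: le_trans Kn.
  by rewrite ler_piMl // ltW.
rewrite /T in Tle.
have -> : 3 * n%:R / (eps ^+ 4 * (k n)%:R) =
    2 * n%:R / (eps ^+ 4 * (k n)%:R) + n%:R / (eps ^+ 4 * (k n)%:R) :> R.
  by field; rewrite !gt_eqF.
lra.
Qed.
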